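(* Let $g_1,g_2\in\mathcal{G}_0$ with $g_2(x)>0$ for $x\in(0,1)$. Suppose the limit $L=\lim_{x\to0^+}g_1(x)/g_2(x)$ exists and is finite. Then for every finite partition $\mathcal{P}$ with $h(g_2,\mathcal{P})<\infty$ we have $h(g_1,\mathcal{P})=L\cdot h(g_2,\mathcal{P})$.
   Context: $\mathcal{G}_0$ is the set of concave functions $g:[0,1]\to\mathbb{R}$ with $g(0)=\lim_{x\to0^+}g(x)=0$. $T$ is a measure-preserving map of a probability space $(X,\Sigma,\mu)$. For a finite measurable partition $\mathcal{P}$, let $\mathcal{P}_n=\bigvee_{i=0}^{n-1}T^{-i}\mathcal{P}$, $H(g,\mathcal{P})=\sum_{A\in\mathcal{P}}g(\mu(A))$, and $h(g,\mathcal{P})=\limsup_{n\to\infty}\frac1nH(g,\mathcal{P}_n)$. *)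

(* Defs.v *)
From Stdlib Require Import Reals Lra List.
Open Scope R_scope.

Record ProbSpace := {
  pt : Type;
  meas : (pt -> Prop) -> Prop;
  mu : (pt -> Prop) -> R;
  meas_full : meas (fun _ => True);
  meas_compl : forall A, meas A -> meas (fun x => ~ A x);
  meas_cunion : forall A : nat -> pt -> Prop,
      (forall n, meas (A n)) -> meas (fun x => exists n, A n x);
  mu_nonneg : forall A, meas A -> 0 <= mu A;
  mu_full : mu (fun _ => True) = 1;
  mu_cadd : forall A : nat -> pt -> Prop,
      (forall n, meas (A n)) ->
      (forall n m x, n <> m -> A n x -> A m x -> False) ->
      infinite_sum (fun n => mu (A n)) (mu (fun x => exists n, A n x))
}.

Definition preimage {X : Type} (T : X -> X) (A : X -> Prop) : X -> Prop :=
  fun x => A (T x).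

Definition measure_preserving (Sp : ProbSpace) (T : pt Sp -> pt Sp) : Prop :=
  forall A, meas Sp A -> meas Sp (preimage T A) /\ mu Sp (preimage T A) = mu Sp A.

Definition is_partition (Sp : ProbSpace) (P : list (pt Sp -> Prop)) : Prop :=
  (forall A, In A P -> meas Sp A) /\
  (forall i j x, (i < length P)%nat -> (j < length P)%nat -> i <> j ->
      nth i P (fun _ => False) x -> nth j P (fun _ => False) x -> False) /\
  (forall x, exists A, In A P /\ A x).

Definition refine {X : Type} (P Q : list (X -> Prop)) : list (X -> Prop) :=
  flat_map (fun A => map (fun B => fun x => A x /\ B x) Q) P.

(** joinT T P n = P_n = P v T^{-1} P v ... v T^{-(n-1)} P  (P_0 = {X}). *)
Fixpoint joinT {X : Type} (T : X -> X) (P : list (X -> Prop)) (n : nat)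
  : list (X -> Prop) :=
  match n with
  | O => (fun _ => True) :: nil
  | S k => refine P (map (preimage T) (joinT T P k))
  end.

Definition Hg (Sp : ProbSpace) (g : R -> R) (P : list (pt Sp -> Prop)) : R :=
  fold_right (fun A acc => g (mu Sp A) + acc) 0 P.

Definition concave_on01 (g : R -> R) : Prop :=
  forall x y t, 0 <= x <= 1 -> 0 <= y <= 1 -> 0 <= t <= 1 ->
    t * g x + (1 - t) * g y <= g (t * x + (1 - t) * y).

Definition in_G0 (g : R -> R) : Prop :=
  concave_on01 g /\ g 0 = 0 /\
  (forall eps, eps > 0 -> exists delta, delta > 0 /\
     forall x, 0 < x < delta -> Rabs (g x) < eps).

Inductive ERbar := Fin (r : R) | PInf | MInf.

Definition is_limsup (u : nat -> R) (l : ERbar) : Prop :=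
  match l with
  | Fin r => forall eps, eps > 0 ->
      (forall N, exists n, (n >= N)%nat /\ u n > r - eps) /\
      (exists N, forall n, (n >= N)%nat -> u n < r + eps)
  | PInf => forall M N, exists n, (n >= N)%nat /\ u n > M
  | MInf => forall M, exists N, forall n, (n >= N)%nat -> u n < M
  end.

(** The sequence (1/n) H(g, P_n), n >= 1 (index shifted: n |-> n+1). *)
Definition entropy_seq (Sp : ProbSpace) (T : pt Sp -> pt Sp) (g : R -> R)
  (P : list (pt Sp -> Prop)) : nat -> R :=
  fun n => Hg Sp g (joinT T P (S n)) / INR (S n).

Definition has_entropy (Sp : ProbSpace) (T : pt Sp -> pt Sp) (g : R -> R)
  (P : list (pt Sp -> Prop)) (l : ERbar) : Prop :=
  is_limsup (entropy_seq Sp T g P) l.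

(* Main.v *)
(** The key is a transfer principle: each refinement P_n consists of
  measurable sets whose masses lie in [0,1] and sum to 1, so a pointwise
  bound f(x) <= g(x) + C x on [0,1] becomes H(f,P_n) <= H(g,P_n) + C.
  Concavity bounds every g in G0 and gives the chord bound g(x) >= x g(1);
  with the limit of the ratio this yields, for each eps > 0, a constant C
  with |g1(x) - L g2(x)| <= eps g2(x) + C x.  Transferred and divided by n,
  it makes (1/n)H(g1,P_n) asymptotically equal to L (1/n)H(g2,P_n), whose
  limsup is L h(g2,P): directly when L >= 0, and when L < 0 because the
  ratio condition then forces |g2(x)| <= c x, so both sides are O(1/n). *)

Require Import Defs.
From Stdlib Require Import Reals List.
From Stdlib Require Import Lra Lia Classical FunctionalExtensionality PropExtensionality.
Open Scope R_scope.

Definition lsum {X : Type} (f : X -> R) (l : list X) : R :=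
  fold_right (fun a acc => f a + acc) 0 l.

Lemma lsum_nil {X} (f : X -> R) : lsum f nil = 0.
Proof. reflexivity. Qed.

Lemma lsum_cons {X} (f : X -> R) a l : lsum f (a :: l) = f a + lsum f l.
Proof. reflexivity. Qed.

Lemma lsum_ext {X} (f g : X -> R) l :
  (forall a, In a l -> f a = g a) -> lsum f l = lsum g l.
Proof.
  induction l as [|a l IH]; intros H; rewrite ?lsum_nil, ?lsum_cons; [reflexivity|].
  rewrite H by (simpl; auto). f_equal. apply IH. intros; apply H; simpl; auto.
Qed.

Lemma lsum_le {X} (f g : X -> R) l :
  (forall a, In a l -> f a <= g a) -> lsum f l <= lsum g l.
Proof.
  induction l as [|a l IH]; intros H; rewrite ?lsum_nil, ?lsum_cons; [lra|].
  assert (f a <= g a) by (apply H; simpl; auto).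
  assert (lsum f l <= lsum g l) by (apply IH; intros; apply H; simpl; auto).
  lra.
Qed.

Lemma lsum_plus {X} (f g : X -> R) l :
  lsum (fun x => f x + g x) l = lsum f l + lsum g l.
Proof. induction l as [|x l IH]; rewrite ?lsum_nil, ?lsum_cons; [ring|]. rewrite IH; ring. Qed.

Lemma lsum_scal {X} (f : X -> R) c l : lsum (fun x => c * f x) l = c * lsum f l.
Proof. induction l as [|x l IH]; rewrite ?lsum_nil, ?lsum_cons; [ring|]. rewrite IH; ring. Qed.

Lemma lsum_zero {X} (l : list X) : lsum (fun _ => 0) l = 0.
Proof. induction l as [|x l IH]; rewrite ?lsum_nil, ?lsum_cons; [reflexivity|]. rewrite IH; ring. Qed.

Lemma lsum_swap {X Y} (F : X -> Y -> R) P Q :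
  lsum (fun a => lsum (fun b => F a b) Q) P = lsum (fun b => lsum (fun a => F a b) P) Q.
Proof.
  induction P as [|a P IH].
  - rewrite lsum_nil. symmetry; apply lsum_zero.
  - rewrite lsum_cons, IH.
    rewrite <- (lsum_plus (fun b => F a b) (fun b => lsum (fun a => F a b) P)).
    apply lsum_ext. intros b _. rewrite lsum_cons. reflexivity.
Qed.

Lemma lsum_flat_map {X Y} (f : X -> list Y) (g : Y -> R) l :
  lsum g (flat_map f l) = lsum (fun a => lsum g (f a)) l.
Proof.
  induction l as [|a l IH]; [reflexivity|].
  simpl flat_map. rewrite lsum_cons, <- IH.
  induction (f a) as [|b m IHm]; simpl app; rewrite ?lsum_nil, ?lsum_cons; [ring|].
  rewrite IHm; ring.
Qed.

Lemma lsum_map {X Y} (h : X -> Y) (g : Y -> R) l :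
  lsum g (map h l) = lsum (fun x => g (h x)) l.
Proof. induction l as [|x l IH]; [reflexivity|]. simpl map. rewrite !lsum_cons, IH; reflexivity. Qed.

Lemma lsum_elem {X} (f : X -> R) l a :
  (forall x, In x l -> 0 <= f x) -> In a l -> f a <= lsum f l.
Proof.
  intros Hpos Ha.
  assert (Hrest : forall m, (forall x, In x m -> 0 <= f x) -> 0 <= lsum f m).
  { intros m Hm. rewrite <- (lsum_zero m). apply lsum_le. exact Hm. }
  induction l as [|y l IH]; [destruct Ha|]. rewrite lsum_cons.
  assert (0 <= f y) by (apply Hpos; simpl; auto).
  assert (0 <= lsum f l) by (apply Hrest; intros; apply Hpos; simpl; auto).
  destruct Ha as [<-|Ha]; [lra|].
  assert (f a <= lsum f l) by (apply IH; auto; intros; apply Hpos; simpl; auto).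
  lra.
Qed.

Lemma set_ext {X} (A B : X -> Prop) : (forall x, A x <-> B x) -> A = B.
Proof.
  intros H. apply functional_extensionality; intros x.
  apply propositional_extensionality, H.
Qed.

Lemma meas_empty (Sp : ProbSpace) : meas Sp (fun _ => False).
Proof.
  replace (fun _ : pt Sp => False) with (fun x : pt Sp => ~ True).
  - apply meas_compl, meas_full.
  - apply set_ext; tauto.
Qed.

Lemma meas_inter (Sp : ProbSpace) A B :
  meas Sp A -> meas Sp B -> meas Sp (fun x => A x /\ B x).
Proof.
  intros HA HB.
  set (C := fun n : nat => match n with O => fun x => ~ A x | _ => fun x => ~ B x end).
  assert (HC : meas Sp (fun x => exists n, C n x)).
  { apply meas_cunion. intros [|n]; apply meas_compl; assumption. }
  replace (fun x => A x /\ B x) with (fun x => ~ exists n, C n x).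
  - apply meas_compl, HC.
  - apply set_ext; intros x; split.
    + intros H. split; apply NNPP; intros H'; apply H; [exists O | exists 1%nat]; exact H'.
    + intros [Ha Hb] [[|n] Hn]; auto.
Qed.

Lemma infinite_sum_const c l : infinite_sum (fun _ => c) l -> c = 0.
Proof.
  intros Hs. apply NNPP; intros Hc.
  assert (Hpos : 0 < Rabs c / 2) by (pose proof (Rabs_pos_lt c Hc); lra).
  destruct (Hs _ Hpos) as [N HN].
  pose proof (HN N (Nat.le_refl N)) as H1. pose proof (HN (S N) (Nat.le_succ_diag_r N)) as H2.
  unfold R_dist in H1, H2. simpl sum_f_R0 in H2.
  assert (Rabs c <= Rabs (sum_f_R0 (fun _ => c) N - l) + Rabs (sum_f_R0 (fun _ => c) N + c - l)).
  { replace c with (- (sum_f_R0 (fun _ => c) N - l) + (sum_f_R0 (fun _ => c) N + c - l)) at 1 by ring.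
    rewrite <- (Rabs_Ropp (sum_f_R0 _ N - l)). apply Rabs_triang. }
  lra.
Qed.

(** The empty set has measure 0, by countable additivity over copies of it. *)
Lemma mu_empty (Sp : ProbSpace) : mu Sp (fun _ => False) = 0.
Proof.
  pose proof (mu_cadd Sp (fun (_ : nat) (_ : pt Sp) => False) (fun _ => meas_empty Sp)
                (fun n m x _ H _ => H)) as H.
  exact (infinite_sum_const _ _ H).
Qed.

Lemma partition_additive (Sp : ProbSpace) P B :
  is_partition Sp P -> meas Sp B ->
  lsum (fun A => mu Sp (fun x => A x /\ B x)) P = mu Sp B.
Proof.
  intros [HPm [HPd HPc]] HB.
  set (d := fun _ : pt Sp => False).
  set (C := fun i x => nth i P d x /\ B x).
  assert (HCm : forall n, meas Sp (C n)).
  { intros n. apply meas_inter; [|exact HB].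
    destruct (nth_in_or_default n P d) as [H|H]; [apply HPm, H | rewrite H; apply meas_empty]. }
  assert (HCd : forall n m x, n <> m -> C n x -> C m x -> False).
  { intros n m x Hnm [Hn _] [Hm _].
    destruct (Nat.lt_ge_cases n (length P)) as [Hn'|Hn'];
      [| rewrite nth_overflow in Hn by exact Hn'; exact Hn].
    destruct (Nat.lt_ge_cases m (length P)) as [Hm'|Hm'];
      [| rewrite nth_overflow in Hm by exact Hm'; exact Hm].
    exact (HPd n m x Hn' Hm' Hnm Hn Hm). }
  pose proof (mu_cadd Sp C HCm HCd) as Hs.
  replace (fun x => exists n, C n x) with B in Hs.
  2:{ apply set_ext; intros x; split.
      - intros Hx. destruct (HPc x) as [A [HA Ax]].
        destruct (In_nth P A d HA) as [n [_ Hn]]. exists n. unfold C. rewrite Hn. tauto.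
      - intros [n [_ Hx]]; exact Hx. }
  (* the series is eventually constant, equal to the finite sum *)
  assert (Hfin : forall N, (length P <= S N)%nat ->
            sum_f_R0 (fun n => mu Sp (C n)) N = lsum (fun A => mu Sp (fun x => A x /\ B x)) P).
  { assert (Hd : mu Sp (fun x => d x /\ B x) = 0).
    { rewrite <- (mu_empty Sp). f_equal. apply set_ext; unfold d; tauto. }
    unfold C; clear - Hd. induction P as [|a P IH]; intros N Hlen.
    - rewrite lsum_nil. apply sum_eq_R0. intros [|i] _; exact Hd.
    - destruct N as [|N]; simpl in Hlen.
      + destruct P; [|simpl in Hlen; lia]. simpl. ring.
      + rewrite decomp_sum by lia. rewrite lsum_cons, <- (IH N) by lia. reflexivity. }
  apply (UL_sequence (fun N => sum_f_R0 (fun n => mu Sp (C n)) N)); [|exact Hs].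
  intros eps Heps. exists (length P). intros n Hn.
  rewrite Hfin by lia. unfold R_dist. rewrite Rminus_diag_eq, Rabs_R0 by reflexivity. exact Heps.
Qed.

Lemma Hg_lsum Sp g (Q : list (pt Sp -> Prop)) : Hg Sp g Q = lsum (fun A => g (mu Sp A)) Q.
Proof. reflexivity. Qed.

Lemma entropy_seq_plus Sp T P f g n :
  entropy_seq Sp T (fun x => f x + g x) P n = entropy_seq Sp T f P n + entropy_seq Sp T g P n.
Proof.
  unfold entropy_seq. rewrite !Hg_lsum.
  rewrite lsum_plus. unfold Rdiv. ring.
Qed.

Lemma entropy_seq_scale Sp T P c g n :
  entropy_seq Sp T (fun x => c * g x) P n = c * entropy_seq Sp T g P n.
Proof.
  unfold entropy_seq. rewrite !Hg_lsum.
  rewrite lsum_scal. unfold Rdiv. ring.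
Qed.

Lemma entropy_seq_zero Sp T P n : entropy_seq Sp T (fun _ => 0) P n = 0.
Proof.
  unfold entropy_seq. rewrite !Hg_lsum.
  rewrite lsum_zero. unfold Rdiv. ring.
Qed.

Section Refinements.

Variables (Sp : ProbSpace) (T : pt Sp -> pt Sp) (P : list (pt Sp -> Prop)).
Hypotheses (HT : measure_preserving Sp T) (HP : is_partition Sp P).

(** Each refinement P_n consists of measurable sets of total mass 1: refining
    by P splits every preimage T^{-1} Q without changing its mass, and T
    preserves mass. *)
Lemma joinT_mass n :
  (forall A, In A (joinT T P n) -> meas Sp A) /\ lsum (mu Sp) (joinT T P n) = 1.
Proof.
  induction n as [|n [IHm IHs]]; cbn [joinT].
  - split.
    + intros A [<-|[]]. apply meas_full.
    + rewrite lsum_cons, lsum_nil, mu_full. ring.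
  - assert (Hpre : forall Q, In Q (map (preimage T) (joinT T P n)) -> meas Sp Q).
    { intros Q HQ. apply in_map_iff in HQ. destruct HQ as [R [<- HR]].
      exact (proj1 (HT R (IHm R HR))). }
    unfold refine. split.
    + intros A HA. apply in_flat_map in HA. destruct HA as [a [Ha HA]].
      apply in_map_iff in HA. destruct HA as [Q [<- HQ]].
      apply meas_inter; [apply (proj1 HP), Ha | apply Hpre, HQ].
    + rewrite lsum_flat_map.
      transitivity (lsum (fun a => lsum (fun Q => mu Sp (fun x => a x /\ Q x))
                                        (map (preimage T) (joinT T P n))) P).
      { apply lsum_ext; intros a _. apply lsum_map. }
      rewrite lsum_swap.
      transitivity (lsum (mu Sp) (map (preimage T) (joinT T P n))).
      { apply lsum_ext. intros Q HQ. apply partition_additive; [exact HP | apply Hpre, HQ]. }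
      rewrite lsum_map, <- IHs. apply lsum_ext. intros R HR.
      exact (proj2 (HT R (IHm R HR))).
Qed.

Lemma joinT_mass_01 n A : In A (joinT T P n) -> 0 <= mu Sp A <= 1.
Proof.
  intros HA. destruct (joinT_mass n) as [Hm Hs]. split.
  - apply mu_nonneg, Hm, HA.
  - rewrite <- Hs. apply lsum_elem; [|exact HA]. intros; apply mu_nonneg, Hm; assumption.
Qed.

(** Transfer principle: a pointwise bound f(x) <= g(x) + C x on [0,1]
    becomes H(f, P_n) <= H(g, P_n) + C, since the masses of P_n sum to 1. *)
Lemma Hg_transfer n f g C :
  (forall x, 0 <= x <= 1 -> f x <= g x + C * x) ->
  Hg Sp f (joinT T P n) <= Hg Sp g (joinT T P n) + C.
Proof.
  intros H. destruct (joinT_mass n) as [_ Hs].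
  rewrite !Hg_lsum.
  replace C with (C * lsum (mu Sp) (joinT T P n)) by (rewrite Hs; ring).
  rewrite <- lsum_scal, <- lsum_plus.
  apply lsum_le. intros A HA. apply H, (joinT_mass_01 n A HA).
Qed.

Lemma entropy_seq_transfer f g C :
  (forall x, 0 <= x <= 1 -> f x <= g x + C * x) ->
  forall n, entropy_seq Sp T f P n <= entropy_seq Sp T g P n + C / INR (S n).
Proof.
  intros H n. unfold entropy_seq.
  assert (Hn : 0 < INR (S n)) by (apply lt_0_INR; lia).
  pose proof (Hg_transfer (S n) f g C H).
  unfold Rdiv. rewrite <- Rmult_plus_distr_r.
  apply Rmult_le_compat_r; [left; apply Rinv_0_lt_compat|]; assumption.
Qed.

Lemma entropy_seq_abs_transfer f g w C :
  (forall x, 0 <= x <= 1 -> Rabs (f x - g x) <= w x + C * x) ->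
  forall n, Rabs (entropy_seq Sp T f P n - entropy_seq Sp T g P n)
            <= entropy_seq Sp T w P n + C / INR (S n).
Proof.
  intros H n.
  assert (Hfg : forall x, 0 <= x <= 1 -> f x <= (g x + w x) + C * x)
    by (intros x Hx; pose proof (H x Hx); pose proof (Rle_abs (f x - g x)); lra).
  assert (Hgf : forall x, 0 <= x <= 1 -> g x <= (f x + w x) + C * x)
    by (intros x Hx; pose proof (H x Hx); pose proof (Rle_abs (- (f x - g x)));
        rewrite Rabs_Ropp in *; lra).
  pose proof (entropy_seq_transfer _ _ C Hfg n). pose proof (entropy_seq_transfer _ _ C Hgf n).
  rewrite entropy_seq_plus in *. apply Rabs_le. lra.
Qed.

Lemma entropy_seq_O_inv f c :
  (forall x, 0 <= x <= 1 -> Rabs (f x) <= c * x) ->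
  forall n, Rabs (entropy_seq Sp T f P n) <= c / INR (S n).
Proof.
  intros H n.
  assert (H' : forall x, 0 <= x <= 1 -> Rabs (f x - 0) <= 0 + c * x)
    by (intros x Hx; rewrite Rminus_0_r, Rplus_0_l; apply H, Hx).
  pose proof (entropy_seq_abs_transfer f (fun _ => 0) (fun _ => 0) c H' n).
  rewrite !entropy_seq_zero, Rminus_0_r, Rplus_0_l in *. assumption.
Qed.

End Refinements.

Lemma G0_chord g : in_G0 g -> forall x, 0 <= x <= 1 -> x * g 1 <= g x.
Proof.
  intros [Hc [H0 _]] x Hx.
  pose proof (Hc 1 0 x ltac:(lra) ltac:(lra) Hx) as H.
  rewrite H0 in H. replace (x * 1 + (1 - x) * 0) with x in H by ring. lra.
Qed.

Lemma Rabs_mult_bound x y : 0 <= x -> - (Rabs y * x) <= x * y <= Rabs y * x.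
Proof.
  intros Hx. pose proof (Rle_abs y). pose proof (Rle_abs (- y)).
  rewrite Rabs_Ropp in *. split; nra.
Qed.

(** Functions in G0 are bounded on [0,1]: the chord bounds them below, and
    concavity at 1/2 gives g(x) <= 2 g(1/2) - g(1-x). *)
Lemma G0_bounded g : in_G0 g -> exists M, 0 <= M /\ forall x, 0 <= x <= 1 -> Rabs (g x) <= M.
Proof.
  intros Hg. exists (2 * Rabs (g (/2)) + Rabs (g 1)).
  pose proof (Rabs_pos (g (/2))); pose proof (Rabs_pos (g 1)). split; [lra|].
  intros x Hx.
  pose proof (G0_chord g Hg x Hx). pose proof (G0_chord g Hg (1 - x) ltac:(lra)).
  pose proof (proj1 Hg x (1 - x) (/2) Hx ltac:(lra) ltac:(lra)) as Hmid.
  replace (/2 * x + (1 - /2) * (1 - x)) with (/2) in Hmid by field.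
  pose proof (Rabs_mult_bound x (g 1) ltac:(lra)).
  pose proof (Rabs_mult_bound (1 - x) (g 1) ltac:(lra)).
  pose proof (Rle_abs (g (/2))).
  apply Rabs_le. lra.
Qed.

Lemma const_le_linear M d x : 0 <= M -> 0 < d <= x -> M <= M / d * x.
Proof.
  intros HM Hd. replace M with (M / d * d) at 1 by (field; lra).
  apply Rmult_le_compat_l; [apply Rmult_le_pos; [lra | left; apply Rinv_0_lt_compat]|]; lra.
Qed.

Definition ratio_limit (g1 g2 : R -> R) (L : R) : Prop :=
  forall eps, eps > 0 -> exists delta, delta > 0 /\
    forall x, 0 < x < delta -> Rabs (g1 x / g2 x - L) < eps.

(** Uniform comparison: g1 - L g2 is small relative to g2 near 0, and
    bounded elsewhere, hence |g1 - L g2| <= eps g2 + C x on [0,1]. *)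
Lemma G0_ratio_estimate g1 g2 L :
  in_G0 g1 -> in_G0 g2 -> (forall x, 0 < x < 1 -> g2 x > 0) -> ratio_limit g1 g2 L ->
  forall eps, eps > 0 -> exists C, forall x, 0 <= x <= 1 ->
    Rabs (g1 x - L * g2 x) <= eps * g2 x + C * x.
Proof.
  intros H1 H2 Hpos HL eps Heps.
  destruct (HL eps Heps) as [d [Hd Hnear]].
  destruct (G0_bounded g1 H1) as [M1 [HM1 B1]]. destruct (G0_bounded g2 H2) as [M2 [HM2 B2]].
  set (d' := Rmin d 1).
  assert (Hd' : 0 < d' <= d /\ d' <= 1)
    by (unfold d'; split; [split; [apply Rmin_pos|apply Rmin_l]|apply Rmin_r]; lra).
  set (K := M1 + Rabs L * M2 + eps * M2).
  assert (HK : 0 <= K) by (unfold K; pose proof (Rabs_pos L); nra).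
  exists (K / d'). intros x Hx.
  assert (HCx : 0 <= K / d' * x)
    by (apply Rmult_le_pos; [apply Rmult_le_pos; [lra | left; apply Rinv_0_lt_compat; lra]|lra]).
  destruct (Req_dec x 0) as [->|Hx0].
  { rewrite (proj1 (proj2 H1)), (proj1 (proj2 H2)), Rmult_0_r, Rminus_0_r, Rabs_R0. lra. }
  destruct (Rlt_le_dec x d') as [Hsmall|Hlarge].
  - assert (Hg2 : g2 x > 0) by (apply Hpos; lra).
    replace (g1 x - L * g2 x) with ((g1 x / g2 x - L) * g2 x) by (field; lra).
    rewrite Rabs_mult, (Rabs_pos_eq (g2 x)) by lra.
    pose proof (Hnear x ltac:(lra)). nra.
  - pose proof (B1 x Hx). pose proof (B2 x Hx).
    pose proof (const_le_linear K d' x HK ltac:(lra)).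
    assert (Rabs (g1 x - L * g2 x) <= M1 + Rabs L * M2).
    { unfold Rminus. eapply Rle_trans; [apply Rabs_triang|].
      rewrite Rabs_Ropp, Rabs_mult. pose proof (Rabs_pos L).
      apply Rplus_le_compat; [lra | apply Rmult_le_compat_l; lra]. }
    pose proof (Rle_abs (- g2 x)). rewrite Rabs_Ropp in *.
    assert (eps * g2 x >= - (eps * M2)) by nra.
    unfold K in *. lra.
Qed.

(** A negative limit L forces g1 < (L/2) g2 < 0 near 0; with the chord bound
    g1(x) >= x g1(1) this gives g2(x) = O(x), so |g2(x)| <= c x on [0,1]. *)
Lemma G0_negative_limit_linear g1 g2 L :
  in_G0 g1 -> in_G0 g2 -> (forall x, 0 < x < 1 -> g2 x > 0) -> ratio_limit g1 g2 L ->
  L < 0 -> exists c, forall x, 0 <= x <= 1 -> Rabs (g2 x) <= c * x.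
Proof.
  intros H1 H2 Hpos HL HL0.
  destruct (HL (- L / 2) ltac:(lra)) as [d [Hd Hnear]].
  destruct (G0_bounded g2 H2) as [M2 [HM2 B2]].
  set (d' := Rmin d 1).
  assert (Hd' : 0 < d' <= d /\ d' <= 1)
    by (unfold d'; split; [split; [apply Rmin_pos|apply Rmin_l]|apply Rmin_r]; lra).
  set (c1 := 2 * g1 1 / L).
  assert (HK : 0 <= M2 / d')
    by (apply Rmult_le_pos; [lra | left; apply Rinv_0_lt_compat; lra]).
  assert (Hup : forall x, 0 <= x <= 1 -> g2 x <= (Rabs c1 + M2 / d') * x).
  { intros x Hx.
    pose proof (Rabs_mult_bound x c1 ltac:(lra)).
    assert (0 <= M2 / d' * x) by (apply Rmult_le_pos; lra).
    destruct (Req_dec x 0) as [->|Hx0]; [rewrite (proj1 (proj2 H2)); lra|].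
    destruct (Rlt_le_dec x d') as [Hsmall|Hlarge].
    - assert (Hg2 : g2 x > 0) by (apply Hpos; lra).
      pose proof (Hnear x ltac:(lra)) as Hr. apply Rabs_def2 in Hr.
      assert (Hg1 : g1 x < L / 2 * g2 x).
      { replace (g1 x) with (g1 x / g2 x * g2 x) by (field; lra).
        apply Rmult_lt_compat_r; lra. }
      pose proof (G0_chord g1 H1 x Hx).
      assert (g2 x <= c1 * x).
      { unfold c1. apply Rmult_le_reg_l with (- L); [lra|].
        replace (- L * (2 * g1 1 / L * x)) with (- 2 * (x * g1 1)) by (field; lra). nra. }
      lra.
    - pose proof (B2 x Hx). pose proof (Rle_abs (g2 x)).
      pose proof (const_le_linear M2 d' x HM2 ltac:(lra)). lra. }
  exists (Rabs c1 + M2 / d' + Rabs (g2 1)). intros x Hx.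
  pose proof (Hup x Hx). pose proof (G0_chord g2 H2 x Hx).
  pose proof (Rabs_mult_bound x (g2 1) ltac:(lra)).
  assert (0 <= (Rabs c1 + M2 / d') * x) by (apply Rmult_le_pos; [pose proof (Rabs_pos c1)|]; lra).
  replace ((Rabs c1 + M2 / d' + Rabs (g2 1)) * x)
    with ((Rabs c1 + M2 / d') * x + Rabs (g2 1) * x) by ring.
  apply Rabs_le. lra.
Qed.

Lemma div_succ_eventually_small K eps :
  eps > 0 -> exists N, forall n, (n >= N)%nat -> K / INR (S n) < eps.
Proof.
  intros He.
  destruct (archimed_cor1 (eps / (Rabs K + 1))) as [N [HN HN0]].
  { apply Rdiv_lt_0_compat; [lra | pose proof (Rabs_pos K); lra]. }
  exists N. intros n Hn.
  assert (HNn : 0 < INR N <= INR (S n)) by (split; [apply lt_0_INR | apply le_INR]; lia).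
  assert (Hinv : 0 < / INR (S n) <= / INR N)
    by (split; [apply Rinv_0_lt_compat | apply Rinv_le_contravar]; lra).
  pose proof (Rabs_pos K). pose proof (Rle_abs K).
  assert (Heps : Rabs K * (eps / (Rabs K + 1)) < eps).
  { replace (Rabs K * (eps / (Rabs K + 1))) with (eps - eps / (Rabs K + 1)) by (field; lra).
    assert (0 < eps / (Rabs K + 1)) by (apply Rdiv_lt_0_compat; lra). lra. }
  unfold Rdiv. apply Rle_lt_trans with (Rabs K * / INR N); [nra|].
  apply Rle_lt_trans with (Rabs K * (eps / (Rabs K + 1))); [|exact Heps].
  apply Rmult_le_compat_l; lra.
Qed.

Lemma limsup_unique u a b : is_limsup u (Fin a) -> is_limsup u (Fin b) -> a = b.
Proof.
  assert (Hlt : forall a b, is_limsup u (Fin a) -> is_limsup u (Fin b) -> ~ a < b).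
  { intros a' b' Ha Hb Hab.
    destruct (Ha ((b' - a') / 2) ltac:(lra)) as [_ [N HN]].
    destruct (Hb ((b' - a') / 2) ltac:(lra)) as [Hfreq _].
    destruct (Hfreq N) as [n [Hn Hu]]. specialize (HN n Hn). lra. }
  intros Ha Hb. destruct (Rtotal_order a b) as [H|[H|H]]; [| exact H |].
  - exfalso; exact (Hlt a b Ha Hb H).
  - exfalso; exact (Hlt b a Hb Ha H).
Qed.

Lemma limsup_O_inv u K :
  (forall n, Rabs (u n) <= K / INR (S n)) -> is_limsup u (Fin 0).
Proof.
  intros H eps He. destruct (div_succ_eventually_small K eps He) as [N0 HN0]. split.
  - intros N. exists (Nat.max N N0). split; [lia|].
    pose proof (H (Nat.max N N0)). pose proof (HN0 (Nat.max N N0) ltac:(lia)).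
    pose proof (Rle_abs (- u (Nat.max N N0))). rewrite Rabs_Ropp in *. lra.
  - exists N0. intros n Hn. pose proof (H n). pose proof (HN0 n Hn).
    pose proof (Rle_abs (u n)). lra.
Qed.

Lemma limsup_scale_nonneg v h c :
  0 <= c -> is_limsup v (Fin h) -> is_limsup (fun n => c * v n) (Fin (c * h)).
Proof.
  intros Hc Hv eps He.
  set (eps' := eps / (c + 1)).
  assert (He' : eps' > 0) by (unfold eps'; apply Rdiv_lt_0_compat; lra).
  assert (Hce : c * eps' < eps).
  { unfold eps'. replace (c * (eps / (c + 1))) with (eps - eps / (c + 1)) by (field; lra).
    assert (0 < eps / (c + 1)) by (apply Rdiv_lt_0_compat; lra). lra. }
  destruct (Hv eps' He') as [Hfreq [N HN]]. split.
  - intros M. destruct (Hfreq M) as [n [Hn Hvn]]. exists n. split; [exact Hn|]. nra.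
  - exists N. intros n Hn. specialize (HN n Hn). nra.
Qed.

Definition asymp_eq (u v : nat -> R) : Prop :=
  forall e, e > 0 -> exists N, forall n, (n >= N)%nat -> Rabs (u n - v n) < e.

Lemma limsup_asymp_eq u v l : is_limsup v (Fin l) -> asymp_eq u v -> is_limsup u (Fin l).
Proof.
  intros Hv Huv eps He.
  destruct (Hv (eps / 2) ltac:(lra)) as [Hfreq [N1 HN1]].
  destruct (Huv (eps / 2) ltac:(lra)) as [N2 HN2]. split.
  - intros M. destruct (Hfreq (Nat.max M N2)) as [n [Hn Hvn]]. exists n. split; [lia|].
    pose proof (HN2 n ltac:(lia)) as Hd. apply Rabs_def2 in Hd. lra.
  - exists (Nat.max N1 N2). intros n Hn.
    pose proof (HN1 n ltac:(lia)). pose proof (HN2 n ltac:(lia)) as Hd.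
    apply Rabs_def2 in Hd. lra.
Qed.

Lemma asymp_eq_of_relative_bound u v L B :
  (exists N, forall n, (n >= N)%nat -> v n <= B) ->
  (forall eps, eps > 0 -> exists C, forall n,
     Rabs (u n - L * v n) <= eps * v n + C / INR (S n)) ->
  asymp_eq u (fun n => L * v n).
Proof.
  intros [N0 HB] Hrel e He.
  set (eps := e / (2 * (Rabs B + 1))).
  assert (Heps : eps > 0) by (unfold eps; pose proof (Rabs_pos B); apply Rdiv_lt_0_compat; lra).
  assert (HepsB : eps * Rabs B < e / 2).
  { unfold eps. pose proof (Rabs_pos B).
    replace (e / (2 * (Rabs B + 1)) * Rabs B) with (e / 2 - e / (2 * (Rabs B + 1))) by (field; lra).
    assert (0 < e / (2 * (Rabs B + 1))) by (apply Rdiv_lt_0_compat; lra). lra. }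
  destruct (Hrel eps Heps) as [C HC].
  destruct (div_succ_eventually_small C (e / 2) ltac:(lra)) as [N1 HN1].
  exists (Nat.max N0 N1). intros n Hn.
  pose proof (HC n). pose proof (HN1 n ltac:(lia)). pose proof (HB n ltac:(lia)).
  pose proof (Rle_abs B).
  assert (eps * v n <= eps * Rabs B) by (apply Rmult_le_compat_l; lra). lra.
Qed.

Theorem mainTheorem4 (Sp : ProbSpace) (T : pt Sp -> pt Sp)
  (HT : measure_preserving Sp T)
  (g1 g2 : R -> R) (Hg1 : in_G0 g1) (Hg2 : in_G0 g2)
  (Hpos : forall x, 0 < x < 1 -> g2 x > 0)
  (L : R)
  (HL : forall eps, eps > 0 -> exists delta, delta > 0 /\
          forall x, 0 < x < delta -> Rabs (g1 x / g2 x - L) < eps)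
  (P : list (pt Sp -> Prop)) (HP : is_partition Sp P)
  (h2 : R) (Hh2 : has_entropy Sp T g2 P (Fin h2)) :
  has_entropy Sp T g1 P (Fin (L * h2)).
Proof.
  unfold has_entropy in *.
  set (s2 := entropy_seq Sp T g2 P) in *.
  assert (Hasymp : asymp_eq (entropy_seq Sp T g1 P) (fun n => L * s2 n)).
  { apply asymp_eq_of_relative_bound with (B := h2 + 1).
    - destruct (Hh2 1 ltac:(lra)) as [_ [N HN]].
      exists N. intros n Hn. specialize (HN n Hn). lra.
    - intros eps Heps.
      destruct (G0_ratio_estimate g1 g2 L Hg1 Hg2 Hpos HL eps Heps) as [C HC].
      exists C. intros n.
      pose proof (entropy_seq_abs_transfer Sp T P HT HP g1 (fun x => L * g2 x)
                    (fun x => eps * g2 x) C HC n) as Hn.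
      rewrite !entropy_seq_scale in Hn. exact Hn. }
  apply (limsup_asymp_eq _ (fun n => L * s2 n)); [|exact Hasymp].
  destruct (Rlt_le_dec L 0) as [Lneg|Lnonneg].
  - (* g2 = O(x) makes (1/n)H(g2,P_n) = O(1/n), so h2 = 0 *)
    destruct (G0_negative_limit_linear g1 g2 L Hg1 Hg2 Hpos HL Lneg) as [c Hc].
    pose proof (entropy_seq_O_inv Sp T P HT HP g2 c Hc) as Hs2.
    assert (h2 = 0) as -> by exact (limsup_unique s2 _ _ Hh2 (limsup_O_inv s2 c Hs2)).
    rewrite Rmult_0_r. apply (limsup_O_inv _ (Rabs L * c)). intros n.
    rewrite Rabs_mult. unfold Rdiv. rewrite Rmult_assoc.
    apply Rmult_le_compat_l; [apply Rabs_pos | apply Hs2].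
  - exact (limsup_scale_nonneg s2 h2 L Lnonneg Hh2).
Qed.
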